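(* The set $S=\{\beta(G): G \text{ a finite group}\}$ is dense in $[0,1]$.
   Context: For a finite group $G$ with identity $e$, $c(G)$ is the number of cyclic subgroups of $G$ (including the trivial subgroup), $i(G)=|\{x\in G: x^2=e\}|$ (so the identity is counted), and $\beta(G)=\frac{i(G)}{c(G)}\in[0,1]$. *)

(* Defs.v *)
From HB Require Import structures.
From mathcomp Require Import all_boot all_order all_algebra all_fingroup all_solvable.
From mathcomp Require Import all_classical all_reals all_analysis.
Set Implicit Arguments.
Unset Strict Implicit.
Unset Printing Implicit Defensive.
Import Order.TTheory GRing.Theory Num.Theory.
Import numFieldNormedType.Exports.
Local Open Scope classical_set_scope.
Local Open Scope ring_scope.

Definition num_cyclic_subgroups (gT : finGroupType) (G : {group gT}) : nat :=
  #|[set H : {group gT} | (H \subset G) && cyclic H]%SET|.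

Definition num_square_roots1 (gT : finGroupType) (G : {group gT}) : nat :=
  #|[set x in G | (x ^+ 2 == 1)%g]%SET|.

Definition beta (R : realType) (gT : finGroupType) (G : {group gT}) : R :=
  (num_square_roots1 G)%:R / (num_cyclic_subgroups G)%:R.

Definition beta_set (R : realType) : set R :=
  [set r : R | exists (gT : finGroupType) (G : {group gT}), r = beta R G].
Arguments beta_set R : clear implicits.

(* The library's [dense] is density in the whole space; this is density of A
   as a subset of the subspace B. *)
Definition dense_in (T : topologicalType) (A B : set T) : Prop :=
  A `<=` B /\ B `<=` closure A.

(* Main.v *)
(* If the element orders of G and H have pairwise gcd at most 2, then
   beta(G x H) = beta(G) beta(H), because c(G) is the sum of 1/phi(o(x)) over
   x in G.  For an odd prime p, every element of D_{2p}^k of order greater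
   than 2 has order p or 2p, which gives
     1 / beta(D_{2p}^k) = 1 + ((2p/(p+1))^k - 1) / (p-1).
   For p large these values start at 1 and the distances to 1 roughly double
   with k.  To approximate 0 < t <= 1, multiply greedily: given G with
   t <= beta(G), take a prime p > |G| and the largest k such that
   beta(G x D_{2p}^k) >= t; this multiplies the error by at most 3/4. *)
From HB Require Import structures.
Require Import Defs.
From mathcomp Require Import all_boot all_order all_algebra all_fingroup all_solvable.
From mathcomp Require Import all_classical all_reals all_analysis.
From mathcomp Require Import lra zify.
Set Implicit Arguments.
Unset Strict Implicit.
Unset Printing Implicit Defensive.
Import Order.TTheory GRing.Theory Num.Theory.
Import numFieldNormedType.Exports.
Local Open Scope classical_set_scope.
Local Open Scope ring_scope.

(** * Totient sums and multiplicativity of [beta] *)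

(** Grouping elements by the cyclic subgroup they generate gives each subgroup total weight 1: it
    has [totient] of its order many generators. *)
Lemma num_cyclic_subgroups_sum (R : realType) (gT : finGroupType)
    (G : {group gT}) :
  (num_cyclic_subgroups G)%:R = \sum_(x in G) (totient #[x]%g)%:R^-1 :> R.
Proof.
rewrite (partition_big (fun x => <[x]>%G)
    (mem [set H : {group gT} | (H \subset G) && cyclic H]%SET)) /=; last first.
  by move=> x Gx; rewrite inE cycle_subG Gx cycle_cyclic.
rewrite /num_cyclic_subgroups -sum1_card natr_sum; apply: eq_bigr => H.
rewrite inE => /andP[sHG /cyclicP[a Ha]].
transitivity (\sum_(x in [set x | generator <[a]>%g x]%SET)
    (totient #[a]%g)%:R^-1 : R).
  rewrite big_const iter_addr_0 -totient_gen -[LHS]mulr1n -[X in _ = X]mulr_natl.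
  by rewrite divff // pnatr_eq0 -lt0n totient_gt0 order_gt0.
apply: eq_big => [x|x]; last first.
  rewrite inE => /eqP e; congr (_%:R^-1); congr totient.
  by rewrite /order e.
rewrite inE /generator -Ha.
apply/eqP/andP => [eHx|[_ /eqP <-]//].
split; last exact/eqP/val_inj.
by rewrite -cycle_subG -eHx.
Qed.

Lemma expg_pair (gT1 gT2 : finGroupType) (x : gT1) (y : gT2) n :
  ((x, y) ^+ n = (x ^+ n, y ^+ n))%g.
Proof. by elim: n => // n IHn; rewrite !expgS IHn. Qed.

Lemma order_pair (gT1 gT2 : finGroupType) (x : gT1) (y : gT2) :
  #[(x, y)]%g = lcmn #[x]%g #[y]%g.
Proof.
have order_dvd (n : nat) :
    (#[(x, y)]%g %| n)%N = (lcmn #[x]%g #[y]%g %| n)%N.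
  by rewrite order_dvdn expg_pair xpair_eqE -!order_dvdn dvdn_lcm.
by apply/eqP; rewrite eqn_dvd order_dvd dvdnn -order_dvd dvdnn.
Qed.

(** When the gcd is 2, one of [m], [n] is twice an odd number, say [m = 2a]. Then the lcm is [a * n]
    with [a] coprime to [n], and [m] and [a] have the same totient. *)
Lemma totient_lcm (m n : nat) :
  (gcdn m n %| 2)%N -> totient (lcmn m n) = (totient m * totient n)%N.
Proof.
move=> /(dvdn_pfactor _ 1 (isT : prime 2))[[|[|//]] _ g].
  by rewrite -totient_coprime /coprime ?g // -muln_lcm_gcd g muln1.
have [/dvdnP[a Ea] /dvdnP[b Eb]] : (2 %| m)%N /\ (2 %| n)%N.
  by split; rewrite -[2%N]/(2 ^ 1)%N -g ?dvdn_gcdl ?dvdn_gcdr.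
(* If [a] and [b] were both even, 4 would divide the gcd. *)
wlog oa : m n a b g Ea Eb / odd a => [H|].
  have [|ea] := boolP (odd a); first exact: (H _ _ _ b).
  have [ob|eb] := boolP (odd b).
    by rewrite lcmnC mulnC (H n m b a) // gcdnC.
  have : (4 %| gcdn m n)%N.
    rewrite dvdn_gcd Ea Eb -[4%N]/(2 * 2)%N !dvdn_pmul2r //.
    by rewrite !dvdn2 ea eb.
  by rewrite g.
have cab : coprime a (b * 2).
  rewrite coprimeMr coprimen2 oa andbT /coprime.
  by move/eqP: g; rewrite Ea Eb -muln_gcdl -[X in (_ == X)%N]mul1n eqn_pmul2r.
have -> : totient m = totient a.
  by rewrite Ea totient_coprime ?coprimen2 // muln1.
rewrite -totient_coprime ?Eb //; congr totient.
apply/eqP; rewrite -(eqn_pmul2r (isT : 0 < 2)%N) -[X in (_ * X)%N == _]/(2 ^ 1)%N.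
by rewrite -{1}g -Eb muln_lcm_gcd Ea; apply/eqP; lia.
Qed.

Section Product.
Variables (gT1 gT2 : finGroupType) (G : {group gT1}) (H : {group gT2}).

Lemma num_square_roots1X :
  num_square_roots1 (setX_group G H)
    = (num_square_roots1 G * num_square_roots1 H)%N.
Proof.
rewrite /num_square_roots1 -cardsX; apply: eq_card => -[x y].
by rewrite !inE /= expg_pair -andbACA.
Qed.

Lemma betaX (R : realType) :
  {in G & H, forall x y, (gcdn #[x]%g #[y]%g %| 2)%N} ->
  beta R (setX_group G H) = beta R G * beta R H.
Proof.
move=> gGH; rewrite /beta num_square_roots1X natrM mulf_div; congr (_ / _).
rewrite !num_cyclic_subgroups_sum mulr_suml.
under [RHS]eq_bigr do rewrite mulr_sumr.
rewrite pair_big_dep /=; apply: eq_big => [[x y]|[x y]]; rewrite inE //=.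
by case/andP=> Gx Hy; rewrite order_pair totient_lcm ?gGH // natrM invfM.
Qed.
End Product.

(** Orders 1 and 2 both have totient 1. This exhibits the count as a subsum of the sum for cyclic
    subgroups. *)
Lemma num_square_roots1_sum (R : realType) (gT : finGroupType)
    (G : {group gT}) :
  (num_square_roots1 G)%:R
    = \sum_(x in G | (x ^+ 2 == 1)%g) (totient #[x]%g)%:R^-1 :> R.
Proof.
rewrite /num_square_roots1 -sum1_card natr_sum.
apply: eq_big => [x|x]; first by rewrite inE.
rewrite inE -order_dvdn => /andP[_].
by move=> /(dvdn_pfactor _ 1 (isT : prime 2))[[|[|//]] _ ->]; rewrite invr1.
Qed.

Lemma num_square_roots1_le (R : realType) (gT : finGroupType)
    (G : {group gT}) :
  (num_square_roots1 G)%:R <= (num_cyclic_subgroups G)%:R :> R.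
Proof.
rewrite num_cyclic_subgroups_sum num_square_roots1_sum.
rewrite [leRHS](bigID (fun x => x ^+ 2 == 1)%g) /=.
by rewrite lerDl sumr_ge0.
Qed.

(** * The values of [beta] on powers of dihedral groups *)

(** Each element that is not a square root of 1 has order [p] or [2 * p], so it contributes
    [1 / (p - 1)] to the totient sum. *)
Lemma num_cyclic_subgroups_exponent2p (R : realType) (gT : finGroupType)
    (G : {group gT}) (p : nat) :
  prime p -> odd p -> {in G, forall x, (#[x]%g %| 2 * p)%N} ->
  (num_cyclic_subgroups G)%:R =
    (num_square_roots1 G)%:R +
    (#|G|%:R - (num_square_roots1 G)%:R) / (p%:R - 1) :> R.
Proof.
move=> pp op oG; have p1 := prime_gt1 pp.
have -> : #|G| = (num_square_roots1 G
    + #|[set x in G | ~~ (x ^+ 2 == 1)%g]%SET|)%N.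
  rewrite -(cardsID [set x | (x ^+ 2 == 1)%g]%SET G).
  by congr (_ + _)%N; apply: eq_card => x; rewrite !inE // andbC.
rewrite natrD addrAC subrr add0r num_cyclic_subgroups_sum.
rewrite (bigID (fun x => x ^+ 2 == 1)%g) /= -num_square_roots1_sum.
congr (_ + _).
rewrite -sum1_card natr_sum mulr_suml.
apply: eq_big => [x|x /andP[Gx]]; first by rewrite inE.
rewrite -order_dvdn mul1r => n2; congr (_^-1).
rewrite -[1 in RHS]/(1%:R) -natrB 1?ltnW // subn1; congr _%:R.
(* Otherwise the order is coprime to [p], hence divides 2. *)
have p_x : (p %| #[x]%g)%N.
  apply: contraR n2; rewrite -prime_coprime // coprime_sym => cxp.
  by rewrite -(Gauss_dvdl _ cxp) oG.
have [d Ed] := dvdnP p_x.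
have : (d %| 2)%N by have := oG _ Gx; rewrite Ed dvdn_pmul2r // ltnW.
rewrite Ed => /(dvdn_pfactor _ 1 (isT : prime 2))[[|[|//]] _ ->].
  by rewrite mul1n totient_prime.
by rewrite totient_coprime ?totient_prime ?mul1n // coprime2n.
Qed.

(* The pair [(s, a)] stands for [a r^s], where the reflection [r] inverts [A] *)
Definition gen_dihedral (A : finZmodType) : Type := (bool * A)%type.

Section GenDihedral.
Variable A : finZmodType.
Local Notation D := (gen_dihedral A).
HB.instance Definition _ := Finite.on D.

Definition gdih_mul (x y : D) : D :=
  (x.1 (+) y.1, x.2 + (if x.1 then - y.2 else y.2)).
Definition gdih_inv (x : D) : D := (x.1, if x.1 then x.2 else - x.2).

Fact gdih_mulA : associative gdih_mul.
Proof.
move=> [[] a] [[] b] [[] c]; rewrite /gdih_mul /=; congr (_, _);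
  by rewrite ?opprD ?opprK addrA.
Qed.

Fact gdih_mul1 : left_id (false, 0) gdih_mul.
Proof. by case=> s a; rewrite /gdih_mul /= add0r. Qed.

Fact gdih_mulV : left_inverse (false, 0) gdih_inv gdih_mul.
Proof. by case=> [[] a]; rewrite /gdih_mul /= ?subrr ?addNr. Qed.

HB.instance Definition _ :=
  Finite_isGroup.Build D gdih_mulA gdih_mul1 gdih_mulV.

(** All [#|A|] reflections are involutions, and a rotation by [a] squares to [a + a], so only the
    identity is added. *)
Lemma num_square_roots1_gen_dihedral :
  (forall a : A, a + a = 0 -> a = 0) ->
  num_square_roots1 [set: D]%G = #|A|.+1.
Proof.
move=> A2; rewrite /num_square_roots1.
have -> : [set x in [set: D]%G | x ^+ 2 == 1]%g
    = ((false, 0) |: [set (true, a) | a in A])%SET :> {set D}.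
  apply/setP => -[s a]; rewrite !inE /= expgS expg1.
  case: s.
    rewrite orFb; apply/eqP/imsetP => [_|_]; first by exists a.
    by congr (_, _); rewrite subrr.
  apply/eqP/orP => [[/A2 ->]|[/eqP[->]|/imsetP[]//]]; first by left.
  by congr (_, _); rewrite addr0.
rewrite cardsU1 card_imset; last by move=> a b [].
by case: imsetP => // -[].
Qed.

Lemma card_gen_dihedral : #|[set: D]%G| = (2 * #|A|)%N.
Proof. by rewrite cardsT card_prod card_bool. Qed.
End GenDihedral.

Lemma Zp_double_eq0 (p : nat) : (1 < p)%N -> odd p ->
  forall a : 'Z_p, a + a = 0 -> a = 0.
Proof.
(* As [p] is odd, [p] copies of [a] sum to [a]; they also sum to 0. *)
move=> p1 op a a2; have : a *+ p./2.*2.+1 = a.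
  by rewrite mulrS -mul2n mulrnA mulr2n a2 mul0rn addr0.
have -> : p./2.*2.+1 = p by rewrite -[RHS](odd_double_half p) op.
by rewrite -mulr_natr pchar_Zp // mulr0.
Qed.

Lemma dihedral_power (p k : nat) : (1 < p)%N -> odd p ->
  exists (gT : finGroupType) (G : {group gT}),
    [/\ #|G| = ((2 * p) ^ k)%N, num_square_roots1 G = (p.+1 ^ k)%N
      & {in G, forall x, (#[x]%g %| 2 * p)%N}].
Proof.
move=> p1 op; have A2 := Zp_double_eq0 p1 op.
have cA : #|'Z_p| = p by rewrite card_ord Zp_cast.
pose D : finGroupType := gen_dihedral 'Z_p.
elim: k => [|k [gT [G [cG iG oG]]]].
  exists D, 1%G; split; first by rewrite cards1.
    rewrite /num_square_roots1 -[RHS](cards1 (1%g : D)); apply: eq_card => x.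
    by rewrite !inE; case: eqP => //= ->; rewrite expg1n eqxx.
  by move=> x /set1P ->; rewrite order1.
exists (D * gT)%type, (setX_group [set: D]%G G).
split.
- by rewrite cardsX card_gen_dihedral cA cG expnS.
- by rewrite num_square_roots1X num_square_roots1_gen_dihedral // cA iG expnS.
case=> x y; rewrite inE => /andP[_ /= Gy]; rewrite order_pair dvdn_lcm oG //.
by rewrite andbT -[X in (_ %| 2 * X)%N]cA -card_gen_dihedral order_dvdG ?inE.
Qed.

(** * Greedy approximation and density *)

Lemma exprn_lt_ex (R : archiRealFieldType) (x e : R) :
  0 <= x -> x < 1 -> 0 < e -> exists n : nat, x ^+ n < e.
Proof.
move=> x0 x1 e0; have nx1 : `|x| < 1 by rewrite ger0_norm.
have [n _ /(_ n (leqnn n))] := cvg_expr nx1 (nbhsx_ballx 0 e e0).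
by rewrite /= -ball_normE /= sub0r normrN ger0_norm ?exprn_ge0 //; exists n.
Qed.

(* As [x <= 2], writing [F k] for the value at [k] we have
   [F k.+1 - 1 <= 2 * (F k - 1) + q]; so the last [F k] not exceeding [T]
   satisfies [(T - 1) / 4 <= F k - 1]. *)
Lemma greedy_power (R : archiRealFieldType) (T x q : R) :
  1 < x -> x <= 2 -> 0 < q -> q <= (T - 1) / 2 ->
  exists k : nat, let F := 1 + (x ^+ k - 1) * q in
    F <= T /\ T - F <= 3 / 4 * (T - 1).
Proof.
move=> x1 x2 q0 qT; pose F k := 1 + (x ^+ k - 1) * q.
have ex : exists k, T < F k.
  (* [T < F n] rearranges to [x^-1 ^+ n < q / (T - 1 + q)]. *)
  have Tq0 : 0 < T - 1 + q by lra.
  have [n] : exists n, x^-1 ^+ n < q / (T - 1 + q).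
    by apply: exprn_lt_ex; rewrite ?invr_ge0 ?invf_lt1 ?divr_gt0 //; lra.
  have xn : 0 < x ^+ n by rewrite exprn_gt0 //; lra.
  rewrite exprVn ltr_pdivlMr //.
  by rewrite mulrC ltr_pdivrMr // => Tq; exists n; rewrite /F; lra.
case: (ex_minnP ex) => -[|k] TFk mink.
  by move: TFk; rewrite /F expr0; lra.
have Fk : F k <= T by rewrite leNgt; apply/negP => /mink; rewrite ltnn.
exists k; split=> //; rewrite -/(F k); move: TFk Fk; rewrite /F exprS.
have : 1 <= x ^+ k by rewrite exprn_ege1 // ltW.
move: (x ^+ k) => y y1 Ty _.
have : x * y * q <= 2 * y * q by rewrite !ler_pM2r //; lra.
by lra.
Qed.

Lemma beta_dihedral_power (R : realType) (p k : nat) : prime p -> odd p ->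
  exists (gT : finGroupType) (G : {group gT}),
    {in G, forall x, (#[x]%g %| 2 * p)%N}
    /\ beta R G = (1 + ((2 * p%:R / p.+1%:R) ^+ k - 1) * (p%:R - 1)^-1)^-1.
Proof.
move=> pp op; have p1 := prime_gt1 pp.
have [gT [G [cG iG oG]]] := dihedral_power k p1 op.
exists gT, G; split=> //.
rewrite /beta (num_cyclic_subgroups_exponent2p R pp op oG) cG iG.
rewrite !natrX natrM expr_div_n.
have : (p.+1%:R : R) ^+ k != 0 by rewrite expf_neq0 // pnatr_eq0.
move: (_ ^+ k) (_ ^+ k) => a b a0; rewrite -[LHS]invf_div; congr _^-1.
by rewrite mulrDl divff // mulrAC mulrBl divff.
Qed.

(** The error is measured by the ratio [T] of [beta R G] to [t]. The new factor divides it by some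
    [F >= 1] with [F <= T], and [T / F - 1 <= T - F], which [greedy_power] bounds. *)
Lemma beta_step (R : realType) (gT : finGroupType) (G : {group gT}) (t : R) :
  0 < t -> t <= beta R G ->
  exists (hT : finGroupType) (H : {group hT}),
    t <= beta R H /\ beta R H - t <= 3 / 4 * (beta R G - t).
Proof.
move=> t0; rewrite le_eqVlt => /predU1P[->|tb].
  by exists gT, G; rewrite subrr mulr0 lexx.
set b := beta R G in tb *; pose T := b / t.
have T1 : 1 < T by rewrite ltr_pdivlMr ?mul1r.
(* The three bounds make [p] odd, prime to all element orders in [G], and large enough that
   [1 / (p - 1) <= (T - 1) / 2]. *)
pose M := maxn 2 (maxn #|G| (Num.bound (2 / (T - 1)))).
have [p Mp pp] := prime_above M.
have op : odd p by case: (even_prime pp) Mp => // ->; rewrite gtn_max.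
have Gp : (#|G| < p)%N by move: Mp; rewrite !gtn_max => /and3P[].
have p1 := prime_gt1 pp.
have pR : 1 < p%:R :> R by rewrite ltr1n.
have qT : (p%:R - 1)^-1 <= (T - 1) / 2.
  have T0 : 0 <= 2 / (T - 1) by rewrite divr_ge0 ?subr_ge0 ?ltW.
  have bp : (Num.bound (2 / (T - 1)) <= p.-1)%N.
    by move: Mp; rewrite !gtn_max => /and3P[_ _]; lia.
  rewrite -[leRHS]invf_div lef_pV2 ?posrE ?divr_gt0 ?subr_gt0 //.
  apply: le_trans (ltW (archi_boundP T0)) _.
  by rewrite -[1]/(1%:R) -natrB 1?ltnW // subn1 ler_nat.
have x1 : 1 < 2 * p%:R / p.+1%:R :> R.
  by rewrite ltr_pdivlMr ?ltr0n // mul1r -natr1; lra.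
have x2 : 2 * p%:R / p.+1%:R <= 2 :> R.
  by rewrite ler_pdivrMr ?ltr0n // -natr1; lra.
have q0 : 0 < (p%:R - 1)^-1 :> R by rewrite invr_gt0 subr_gt0.
have [k] := greedy_power x1 x2 q0 qT.
have [hT [H [oH bH]]] := beta_dihedral_power R k pp op.
have F1 : 1 <= 1 + ((2 * p%:R / p.+1%:R) ^+ k - 1) * (p%:R - 1)^-1 :> R.
  by rewrite lerDl pmulr_lge0 // subr_ge0 exprn_ege1 // ltW.
move: bH F1; set F := (1 + _) => bH F1 /= [FT TF].
exists (gT * hT)%type, (setX_group G H).
have F0 : 0 < F by lra.
rewrite betaX => [|x y Gx Hy]; last first.
  (* The gcd divides [2 * p]; being coprime to [p], it divides 2. *)
  have /Gauss_dvdl <- : coprime (gcdn #[x]%g #[y]%g) p.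
    rewrite coprime_sym prime_coprime //; apply: contraL Gp => pg.
    rewrite -leqNgt (leq_trans (dvdn_leq (order_gt0 x) _)) //.
      exact: dvdn_trans pg (dvdn_gcdl _ _).
    by rewrite dvdn_leq // order_dvdG.
  by rewrite (dvdn_trans (dvdn_gcdr _ _)) // oH.
have bE : b = T * t by rewrite divfK // gt_eqF.
rewrite -/b bH bE; split; first by rewrite ler_pdivlMr // mulrC ler_pM2r.
have : T / F - 1 <= T - F.
  by rewrite -(ler_pM2r F0) mulrBl divfK ?gt_eqF //; nra.
move=> TF'; have : T / F - 1 <= 3 / 4 * (T - 1) by exact: le_trans TF.
by move=> /(ler_wpM2r (ltW t0)); lra.
Qed.

Lemma beta_approx (R : realType) (t e : R) : 0 < t -> t <= 1 -> 0 < e ->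
  exists (gT : finGroupType) (G : {group gT}),
    t <= beta R G /\ beta R G - t < e.
Proof.
move=> t0 t1 e0.
have iter_step n : exists (gT : finGroupType) (G : {group gT}),
    t <= beta R G /\ beta R G - t <= (3 / 4) ^+ n.
  elim: n => [|n [gT [G [tG Ge]]]].
    (* Exponent 0 gives [beta] equal to 1; any odd prime would do for 3. *)
    have [gT [G [_ bG]]] := @beta_dihedral_power R 3 0 isT isT.
    exists gT, G; rewrite bG !expr0 subrr mul0r addr0 invr1; lra.
  have [hT [H [tH He]]] := beta_step t0 tG.
  exists hT, H; split=> //; rewrite exprS; lra.
have [n ne] : exists n, (3 / 4 : R) ^+ n < e by apply: exprn_lt_ex => //; lra.
have [gT [G [tG Ge]]] := iter_step n.
by exists gT, G; split=> //; apply: le_lt_trans ne.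
Qed.

Theorem theorem1p2 (R : realType) :
  dense_in (beta_set R) `[0, 1].
Proof.
split=> [_ [gT [G ->]]|r].
  rewrite /= in_itv /= /beta divr_ge0 //=.
  have ic := num_square_roots1_le R G.
  rewrite ler_pdivrMr ?mul1r // (lt_le_trans _ ic) // ltr0n card_gt0.
  by apply/set0Pn; exists 1%g; rewrite inE group1 expg1n eqxx.
rewrite /= in_itv /= => /andP[r0 r1] B /nbhs_ballP[e /= e0 reB].
(* [beta_approx] needs a positive target, so [r = 0] is replaced by a nearby [t > 0]. Approximating
   [t] from above within [r + e - t] stays in the ball around [r]. *)
have [t [t0 t1 rt te]] : exists t : R, [/\ 0 < t, t <= 1, r <= t & t < r + e].
  exists (Num.max r (Num.min 1 (e / 2))).
  by rewrite lt_max ge_max le_max gt_max lt_min ge_min gt_min; split; lra.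
have re : 0 < r + e - t by lra.
have [gT [G [tG Ge]]] := beta_approx t0 t1 re.
exists (beta R G); split; first by exists gT, G.
by apply: reB; rewrite -ball_normE /= ltr_norml; lra.
Qed.
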